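(* Let $k$ be a positive integer. If $G$ is a $2k$-connected $(P_2\cup kP_1)$-free graph with $\tau(G)>1$, then $G$ is hamiltonian-connected.
   Context: All graphs are finite and simple. For a graph $H$, a graph $G$ is $H$-free if $G$ contains no induced subgraph isomorphic to $H$. $P_n$ is the path on $n$ vertices, $P_1$ is a single vertex, and $P_2\cup kP_1$ is the disjoint union of an edge and $k$ isolated vertices. For a graph $G$, $c(G)$ is the number of components of $G$. The toughness of $G$ is $\tau(G)=\min\{|S|/c(G-S): S\subseteq V(G),\ c(G-S)\ge 2\}$ if $G$ is not complete, and $\tau(G)=\infty$ if $G$ is complete. A graph is hamiltonian-connected if for every two distinct vertices $a,b$ there is a path from $a$ to $b$ containing all vertices of the graph. *)

(* Defs.v *)
From mathcomp Require Import all_boot all_order all_algebra.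
Set Implicit Arguments. Unset Strict Implicit. Unset Printing Implicit Defensive.
Import Order.TTheory GRing.Theory Num.Theory.

Definition simple_graph (T : finType) (e : rel T) : Prop :=
  symmetric e /\ irreflexive e.

Definition induced_sub (U T : finType) (h : rel U) (e : rel T) : Prop :=
  exists f : U -> T, injective f /\ forall i j, e (f i) (f j) = h i j.

Definition H_free (U T : finType) (h : rel U) (e : rel T) : Prop :=
  ~ induced_sub h e.

Definition P2_kP1 (k : nat) : rel 'I_(k.+2) :=
  fun i j => ((val i == 0) && (val j == 1)) || ((val i == 1) && (val j == 0)).

Arguments P2_kP1 k : clear implicits.

Definition del_rel (T : finType) (e : rel T) (S : {set T}) : rel T :=
  fun x y => [&& e x y, x \notin S & y \notin S].

Definition comp_of (T : finType) (e : rel T) (S : {set T}) (x : T) : {set T} :=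
  [set y | (y \notin S) && connect (del_rel e S) x y].

Definition ncomp (T : finType) (e : rel T) (S : {set T}) : nat :=
  #|[set comp_of e S x | x in ~: S]|.

Definition connected_graph (T : finType) (e : rel T) (S : {set T}) : Prop :=
  forall x y, x \notin S -> y \notin S -> connect (del_rel e S) x y.

Definition k_connected (T : finType) (e : rel T) (m : nat) : Prop :=
  m < #|T| /\ forall S : {set T}, #|S| < m -> connected_graph e S.

(* tau(G) > t.  tau(G) is the minimum of |S|/c(G-S) over S with c(G-S) >= 2
   (and +infinity when G is complete, in which case no such S exists), so
   tau(G) > t iff every such S has |S|/c(G-S) > t. *)
Definition toughness_gt (T : finType) (e : rel T) (t : rat) : Prop :=
  forall S : {set T}, 2 <= ncomp e S ->
    (t < (#|S|%:R / (ncomp e S)%:R : rat))%R.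

Definition ham_path (T : finType) (e : rel T) (a b : T) : Prop :=
  exists s : seq T, [/\ path e a s, last a s = b, uniq (a :: s)
                      & forall v, v \in a :: s].

Definition hamiltonian_connected (T : finType) (e : rel T) : Prop :=
  forall a b : T, a != b -> ham_path e a b.

(* Main.v *)
Require Import Defs.
From mathcomp Require Import all_boot all_order all_algebra.
From mathcomp Require Import zify.

(** Let [P] be a longest path from [a] to [b], suppose that it misses a vertex
    [x], let [H] be the component of [x] in [G - P], and [A] the set of
    neighbours of [H] on [P]; [2k]-connectivity gives [#|A| >= 2k].  By the usual
    rerouting argument [I], made of [x] and the successors of [A], is independent,
    and [#|I| >= 2k].  Since [G] is [(P2 + kP1)]-free, a vertex outside [I] with a
    neighbour in [I] (a hub) misses at most [k - 1] vertices of [I], so any two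
    hubs have two common neighbours in [I]; for the same reason the non-hubs
    form an independent set.  If two consecutive vertices of [P] were hubs, or if
    a hub were off [P], two common neighbours in [I] would allow [P] to be
    lengthened.  So all hubs lie on [P] and no two are consecutive; as [x] is a
    non-hub off [P], there are at least as many non-hubs as hubs, and deleting
    the hubs contradicts [tau(G) > 1]. *)

Set Implicit Arguments. Unset Strict Implicit. Unset Printing Implicit Defensive.
Import GRing.Theory Num.Theory.

(** * Contiguous segments of a sequence *)

Section Segments.
Variable T : eqType.
Implicit Types p : seq T.

(** Half-open: position [j] is excluded, so consecutive segments concatenate without overlap. *)
Definition seg p i j := drop i (take j p).

Lemma size_seg p i j : j <= size p -> size (seg p i j) = j - i.
Proof. by move=> jp; rewrite size_drop size_takel. Qed.

Lemma seg_cat p i j m : i <= j -> j <= m -> seg p i j ++ seg p j m = seg p i m.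
Proof.
move=> ij jm; rewrite /seg -{2}(cat_take_drop j (take m p)) take_takel // drop_cat.
case: ltnP => // pi; rewrite (drop_oversize pi).
have [jp|pj] := leqP j (size p).
  move: pi; rewrite size_takel // => ji; have -> : i = j by lia.
  by rewrite subnn drop0.
by rewrite !drop_oversize // size_take; case: ifP; lia.
Qed.

Lemma seg_all p : seg p 0 (size p) = p.
Proof. by rewrite /seg take_size drop0. Qed.

End Segments.

(** * Paths with prescribed ends, and reroutings of a longest one *)

Section Epath.
Variables (T : eqType) (e : rel T).
Hypothesis e_sym : symmetric e.
Implicit Types p q r s : seq T.

(** Unlike in [path], the first vertex belongs to the sequence, so segments, reversals and
    concatenations of paths are again of this form. *)
Definition epath (u w : T) s :=
  if s is z :: s' then [&& z == u, path e z s' & last z s' == w] else false.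

Lemma epath_cat u w u' w' s s' :
  epath u w s -> e w u' -> epath u' w' s' -> epath u w' (s ++ s').
Proof.
case: s => [|z s] //= /and3P[zu zs /eqP<-] ez.
case: s' => [|z' s'] //= /and3P[/eqP-> zs' /eqP<-].
by rewrite zu cat_path zs /= ez zs' last_cat /= eqxx.
Qed.

Lemma epath_rev u w s : epath u w s -> epath w u (rev s).
Proof.
case: s => [|z s] //= /and3P[/eqP-> us /eqP lw]; rewrite -lw.
case/lastP: s us lw => [|s y] us lw; first by rewrite /= eqxx.
rewrite last_rcons rev_cons rev_rcons /= eqxx.
have := rev_path e u (rcons s y).
rewrite last_rcons belast_rcons rev_cons => ->.
rewrite last_rcons eqxx andbT.
by rewrite (eq_path (e' := e)) // => i j /=; rewrite e_sym.
Qed.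

Lemma epath_seg x0 u w s i j : epath u w s -> i < j -> j <= size s ->
  epath (nth x0 s i) (nth x0 s j.-1) (seg s i j).
Proof.
move=> us ij js; have ss : sorted e s by case: s us {js} => [|z s] //= /and3P[].
have := size_seg i js.
have hd : nth x0 (seg s i j) 0 = nth x0 s i by rewrite nth_drop addn0 nth_take.
have la : nth x0 (seg s i j) (j - i).-1 = nth x0 s j.-1.
  rewrite nth_drop nth_take; last by lia.
  by congr nth; lia.
have : sorted e (seg s i j) by apply: drop_sorted; apply: take_sorted.
case: (seg s i j) hd la => [|z t] /=; first by move=> _ _ _; lia.
move=> -> <- zt sz; rewrite eqxx zt /= -sz /=.
by rewrite -[size t]/((size (z :: t)).-1) nth_last.
Qed.

Lemma epath_nth0 x0 u w s : epath u w s -> nth x0 s 0 = u.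
Proof. by case: s => [|z s] //= /and3P[/eqP]. Qed.

Lemma epath_nth_last x0 u w s : epath u w s -> nth x0 s (size s).-1 = w.
Proof. by rewrite nth_last; case: s => [|z s] //= /and3P[_ _ /eqP]. Qed.

Variables (a b x0 : T) (p : seq T).
Hypotheses (p_ab : epath a b p) (p_uniq : uniq p).
Hypothesis p_max : forall r, epath a b r -> uniq r -> size r <= size p.

(** The permutation hypothesis yields both that [r] has no repetition and that it is longer than
    [p]; by [permP] it reduces to linear arithmetic on segment counts. *)
Lemma longest_no_extension q r : q != [::] -> uniq q -> ~~ has [in p] q ->
  epath a b r -> perm_eq r (p ++ q) -> False.
Proof.
move=> q0 q_uniq qp r_ab rpq.
have r_uniq : uniq r by rewrite (perm_uniq rpq) cat_uniq p_uniq qp.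
have := p_max r_ab r_uniq; rewrite (perm_size rpq) size_cat.
by case: (q) q0 => //= *; lia.
Qed.

Lemma seg_count P i j : i <= j -> j <= size p ->
  count P (seg p 0 i) + count P (seg p i j) + count P (seg p j (size p)) = count P p.
Proof.
by move=> ij jp; rewrite -[in RHS](seg_all p) -(@seg_cat _ p 0 j (size p)) //
  -(@seg_cat _ p 0 i j) // !count_cat.
Qed.

Lemma seg_count_mid P i j m : i <= j -> j <= m ->
  count P (seg p i m) = count P (seg p i j) + count P (seg p j m).
Proof. by move=> ij jm; rewrite -(seg_cat p ij jm) count_cat. Qed.

(* [i] and [j] index the successors on [p] of the two ends of the detour [q]. *)
Definition detour i j q := exists h h',
  [/\ epath h h' q, uniq q, ~~ has [in p] q & e (nth x0 p i.-1) h /\ e h' (nth x0 p j.-1)].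

Lemma seg_first i : 0 < i -> i <= size p ->
  epath a (nth x0 p i.-1) (seg p 0 i).
Proof. by move=> i0 ip; have := epath_seg x0 p_ab i0 ip; rewrite (epath_nth0 x0 p_ab). Qed.

Lemma seg_final i : i < size p -> epath (nth x0 p i) b (seg p i (size p)).
Proof. by move=> ip; have := epath_seg x0 p_ab ip (leqnn _); rewrite (epath_nth_last x0 p_ab). Qed.

Lemma epath_neq0 u w s : epath u w s -> s != [::].
Proof. by case: s. Qed.

(** Write p_i for the entry of [p] at position [i]. The longer path is a..p_(i-1), [q], p_i..b. *)
Lemma no_detour_succ i q : 0 < i -> i < size p -> ~ detour i i.+1 q.
Proof.
move=> i0 ip [h [h' [hq uq qp [eh eh']]]].
have r1 := epath_cat (epath_cat (seg_first i0 (ltnW ip)) eh hq) eh' (seg_final ip).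
apply: (longest_no_extension (epath_neq0 hq) uq qp r1).
apply/permP => P; rewrite !count_cat.
move: (seg_count P (leq0n i) (ltnW ip)); rewrite [seg p 0 0]drop_oversize ?take0 //=.
by clear; lia.
Qed.

(** The longer path is a..p_(i-1), [q], p_(j-1)..p_i backwards, p_j..b. *)
Lemma detour_nonadj i j q : 0 < i -> i < j -> j < size p -> detour i j q ->
  ~ e (nth x0 p i) (nth x0 p j).
Proof.
move=> i0 ij jp [h [h' [hq uq qp [eh eh']]]] eij.
have ip := ltn_trans ij jp.
have r1 := epath_cat (epath_cat (epath_cat (seg_first i0 (ltnW ip)) eh hq) eh'
  (epath_rev (epath_seg x0 p_ab ij (ltnW jp)))) eij (seg_final jp).
apply: (longest_no_extension (epath_neq0 hq) uq qp r1).
apply/permP => P; rewrite !count_cat count_rev.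
by move: (seg_count P (ltnW ij) (ltnW jp)); clear; lia.
Qed.

(** The rerouting of [detour_nonadj], with [y] standing between p_i and p_j in place of an edge. *)
Lemma detour_insert i j q y : 0 < i -> i < j -> j < size p -> detour i j q ->
  y \notin p -> y \notin q -> e y (nth x0 p i) -> ~ e y (nth x0 p j).
Proof.
move=> i0 ij jp [h [h' [hq uq qp [eh eh']]]] yp yq ei ej.
have ip := ltn_trans ij jp.
rewrite e_sym in ei.
have hy : epath y y [:: y] by rewrite /= eqxx.
have r1 := epath_cat (epath_cat (epath_cat (epath_cat (seg_first i0 (ltnW ip)) eh hq) eh'
  (epath_rev (epath_seg x0 p_ab ij (ltnW jp)))) ei hy) ej (seg_final jp).
apply: (@longest_no_extension (y :: q) _ _ _ _ r1) => //=.
- by rewrite yq.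
- by rewrite negb_or yp.
apply/permP => P; rewrite !count_cat count_rev /=.
by move: (nat_of_bool _) (seg_count P (ltnW ij) (ltnW jp)) => n; clear; lia.
Qed.

(** The edge p_t p_(t+1) is given up, and its ends are joined to p_i and p_j instead. The route
    depends on where this edge lies relative to [i] and [j]. *)
Lemma detour_crossing i j t q : 0 < i -> i < j -> j < size p -> t.+1 < size p ->
  j != t.+1 -> i != t.+1 -> detour i j q ->
  [/\ e (nth x0 p i) (nth x0 p t), e (nth x0 p j) (nth x0 p t),
      e (nth x0 p i) (nth x0 p t.+1) & e (nth x0 p j) (nth x0 p t.+1)] -> False.
Proof.
move=> i0 ij jp tp jt it [h [h' [hq uq qp [eh eh']]]] [it0 jt0 it1 jt1].
have ip := ltn_trans ij jp.
have [jlet|tltj] := leqP j t.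
  have jt' : j < t.+1 by [].
  (* Route: a..p_(i-1), [q], p_(j-1)..p_i, p_t..p_j, p_(t+1)..b. *)
  have r1 := epath_cat (epath_cat (epath_cat (epath_cat (seg_first i0 (ltnW ip)) eh hq) eh'
    (epath_rev (epath_seg x0 p_ab ij (ltnW jp)))) it0
    (epath_rev (epath_seg x0 p_ab jt' (ltnW tp)))) jt1 (seg_final tp).
  apply: (longest_no_extension (epath_neq0 hq) uq qp r1).
  apply/permP => P; rewrite !count_cat !count_rev.
  by move: (seg_count P (ltnW ij) (ltnW jp))
    (seg_count_mid P (ltnW jt') (ltnW tp)); clear; lia.
have {jt tltj} tj : t.+1 < j by rewrite ltn_neqAle eq_sym jt.
have [ilet|tlti] := leqP i t.
  have it' : i < t.+1 by [].
  rewrite e_sym in it1; rewrite e_sym in jt0.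
  (* Route: a..p_(i-1), [q], p_(j-1)..p_(t+1), p_i..p_t, p_j..b. *)
  have r1 := epath_cat (epath_cat (epath_cat (epath_cat (seg_first i0 (ltnW ip)) eh hq) eh'
    (epath_rev (epath_seg x0 p_ab tj (ltnW jp)))) it1
    (epath_seg x0 p_ab it' (ltnW tp))) jt0 (seg_final jp).
  apply: (longest_no_extension (epath_neq0 hq) uq qp r1).
  apply/permP => P; rewrite !count_cat !count_rev.
  by move: (seg_count P (ltnW ij) (ltnW jp))
    (seg_count_mid P (ltnW it') (ltnW tj)); clear; lia.
have {it tlti} ti : t.+1 < i by rewrite ltn_neqAle eq_sym it.
rewrite e_sym in it0; rewrite e_sym in jt1; rewrite e_sym in eh; rewrite e_sym in eh'.
(* Route: a..p_t, p_i..p_(j-1), [q] reversed, p_(i-1)..p_(t+1), p_j..b. *)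
have r1 := epath_cat (epath_cat (epath_cat (epath_cat (seg_first (ltn0Sn t) (ltnW tp)) it0
    (epath_seg x0 p_ab ij (ltnW jp))) eh' (epath_rev hq)) eh
    (epath_rev (epath_seg x0 p_ab ti (ltnW ip)))) jt1 (seg_final jp).
apply: (longest_no_extension (epath_neq0 hq) uq qp r1).
apply/permP => P; rewrite !count_cat !count_rev.
by move: (seg_count P (ltnW ij) (ltnW jp))
  (seg_count_mid P (leq0n t.+1) (ltnW ti)); clear; lia.
Qed.

End Epath.

Lemma count_no_two_consecutive (T : eqType) (P : pred T) (s : seq T) :
  sorted (fun u v => ~~ (P u && P v)) s -> count P s <= (count (predC P) s).+1.
Proof.
case: s => [|x s] //= xs.
(* Strengthened for the induction: the extra unit is available on the tail only if the head fails
   [P]. *)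
suff : count P s <= count (predC P) s + ~~ P x by case: (P x) => /=; lia.
elim: s x xs => [|y s IHs] x //= /andP[xy /IHs].
by case: (P x) (P y) xy => [] [] //=; lia.
Qed.

(** * Consequences of forbidding the induced subgraph and of toughness *)

Section Graph.
Variables (k : nat) (T : finType) (e : rel T).
Hypotheses (e_sym : symmetric e) (e_irr : irreflexive e).

Lemma P2_kP1_free_bound (u v : T) (K : {set T}) :
  H_free (P2_kP1 k) e -> e u v ->
  {in K &, forall x y, ~~ e x y} -> {in K, forall x, ~~ e u x && ~~ e v x} ->
  #|K| < k.
Proof.
move=> free uv Kind Kuv; rewrite ltnNge; apply/negP => kK; apply: free.
(* The edge goes to [u], [v] and the isolated vertices to distinct members of [K]; the default [u]
   is never reached. *)
pose g (n : nat) := nth u [:: u, v & enum K] n.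
have gK n : 1 < n -> n < k.+2 -> g n \in K.
  case: n => [|[|n]] // _ nk.
  by rewrite /g /= -mem_enum mem_nth // -cardE; lia.
have uK : u \notin K by apply/negP => /Kuv; rewrite (e_sym v) uv andbF.
have vK : v \notin K by apply/negP => /Kuv; rewrite uv.
have uq : uniq [:: u, v & enum K].
  rewrite /= inE !mem_enum (negPf uK) (negPf vK) enum_uniq orbF andbT /= andbT.
  by apply: contraTneq uv => ->; rewrite e_irr.
have szk : k.+2 <= size [:: u, v & enum K] by rewrite /= -cardE.
exists (fun i : 'I_k.+2 => g i); split.
  move=> i j /eqP; rewrite /g nth_uniq //; first by move/eqP/val_inj.
    by apply: leq_trans szk.
  by apply: leq_trans szk.
move=> [i ik] [j jk]; rewrite /P2_kP1 /=.
case: (ltnP 1 i) => i1; case: (ltnP 1 j) => j1.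
- rewrite (negPf (Kind _ _ (gK _ i1 ik) (gK _ j1 jk))).
  by case: i {ik} i1 => [|[]].
- have /Kuv/andP[] := gK _ i1 ik.
  by case: i i1 {ik} => [|[|i]] //= _; case: j j1 {jk} => [|[|j]] //= _ /negPf h1 /negPf h2;
    rewrite e_sym.
- have /Kuv/andP[] := gK _ j1 jk.
  by case: j j1 {jk} => [|[|j]] //= _; case: i i1 {ik} => [|[|i]] //= _ /negPf h1 /negPf h2.
- by case: i i1 {ik} => [|[|i]] //= _; case: j j1 {jk} => [|[|j]] //= _;
    rewrite /g /= ?e_irr // e_sym.
Qed.

(** Each vertex outside [S] is a component by itself. *)
Lemma ncomp_coindependent (S : {set T}) :
  {in ~: S &, forall x y, ~~ e x y} -> ncomp e S = #|~: S|.
Proof.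
move=> ind; rewrite /ncomp.
have compE x : x \in ~: S -> comp_of e S x = [set x].
  move=> xS; apply/setP => y; rewrite !inE.
  apply/andP/eqP => [[yS /connectP[[|z s] //= /andP[/and3P[xz _ zS] _] _]]|->].
    by move: (ind x z xS); rewrite inE zS xz => /(_ isT).
  by move: xS; rewrite inE => ->; rewrite connect0.
rewrite (eq_in_imset (g := set1)) ?card_imset //; exact: set1_inj.
Qed.

Lemma card_lt_of_tough (S : {set T}) : toughness_gt e 1%R ->
  {in ~: S &, forall x y, ~~ e x y} -> 1 < #|~: S| -> #|~: S| < #|S|.
Proof.
move=> tough ind S1; have := tough S; rewrite ncomp_coindependent // => /(_ S1).
by rewrite ltr_pdivlMr ?ltr0n ?(ltnW S1) // mul1r ltr_nat.
Qed.

(** Each of [v] and [w] misses at most k - 1 vertices of [I], which leaves at least 2k - 2(k - 1) =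
    2 common neighbours. *)
Lemma common_neighbours (I : {set T}) (v w : T) :
  H_free (P2_kP1 k) e -> {in I &, forall x y, ~~ e x y} -> 2 * k <= #|I| ->
  (v \notin I) && [exists u in I, e v u] -> (w \notin I) && [exists u in I, e w u] ->
  exists u u', [/\ u \in I, u' \in I, u != u', e v u && e w u & e v u' && e w u'].
Proof.
move=> free indI cardI.
have miss y : (y \notin I) && [exists u in I, e y u] ->
    #|[set u in I | ~~ e y u]| < k.
  case/andP=> yI /existsP[u /andP[uI yu]].
  (* The edge is [y] with its neighbour [u] in [I]; independence keeps [u] away from the missed
     vertices. *)
  apply: (P2_kP1_free_bound free yu) => [z z'|z].
    by rewrite !inE => /andP[zI _] /andP[z'I _]; apply: indI.
  by rewrite inE => /andP[zI ->]; apply: indI.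
move=> /miss mv /miss mw.
have /card_gt1P[u [u' [uC u'C uu']]] : 1 < #|[set u in I | e v u && e w u]|.
  have := cardsID [set u | e v u && e w u] I.
  have -> : I :&: [set u | e v u && e w u] = [set u in I | e v u && e w u].
    by apply/setP => z; rewrite !inE.
  have -> : I :\: [set u | e v u && e w u] =
      [set u in I | ~~ e v u] :|: [set u in I | ~~ e w u].
    by apply/setP => z; rewrite !inE negb_and -andb_orr andbC.
  have := (leq_card_setU [set u in I | ~~ e v u] [set u in I | ~~ e w u]).1.
  by move: mv mw cardI; clear; lia.
by exists u, u'; move: uC u'C; rewrite !inE => /andP[-> ->] /andP[-> ->].
Qed.

(** * Components off a path and their attachments *)

Lemma comp_notin (S : {set T}) x y : y \in comp_of e S x -> y \notin S.
Proof. by rewrite inE => /andP[]. Qed.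

Lemma comp_closed (S : {set T}) x y z :
  y \in comp_of e S x -> e y z -> z \notin S -> z \in comp_of e S x.
Proof.
rewrite !inE => /andP[yS xy] yz zS; rewrite zS /=.
by apply: connect_trans xy (connect1 _); rewrite /del_rel yz yS zS.
Qed.

Lemma comp_epath (S : {set T}) x y z : y \in comp_of e S x -> z \in comp_of e S x ->
  exists q, [/\ epath e y z q, uniq q & {subset q <= comp_of e S x}].
Proof.
move=> yH; rewrite inE => /andP[zS xz].
have dsym : connect_sym (del_rel e S).
  apply: sym_connect_sym => u v; rewrite /del_rel e_sym.
  by case: (e v u) (u \in S) (v \in S) => [] [] [].
have xy : connect (del_rel e S) x y by move: yH; rewrite inE => /andP[].
have /connectP[s0 ys0 ->] : connect (del_rel e S) y z.
  by apply: connect_trans xz; rewrite dsym.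
case/shortenP: ys0 => s ys us _; exists (y :: s); split=> //.
  rewrite /= !eqxx andbT /=.
  by apply: sub_path ys => u v /and3P[].
elim: s y yH ys {us xy} => [|v s IHs] y yH /=; first by move=> _ u; rewrite inE => /eqP->.
case/andP=> /and3P[yv _ vS] vs u; rewrite inE => /predU1P[->//|].
by apply: IHs vs u; apply: comp_closed yH yv vS.
Qed.

Definition attachments (p : seq T) (x : T) : {set T} :=
  [set u in p | [exists h in comp_of e [set z in p] x, e u h]].

(** The attachments separate [x] from [c]: a walk from [x] that avoids them never leaves the
    component of [x], whereas [c] lies on [p]. The vertex [c] witnesses that there is something to
    separate. *)
Lemma card_attachments m (p : seq T) x c : k_connected e m ->
  x \notin p -> c \in p -> c \notin attachments p x -> m <= #|attachments p x|.
Proof.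
move=> [_ conn] xp cp cA; rewrite leqNgt; apply/negP => /conn/(_ x c) xc.
have xH : x \in comp_of e [set z in p] x by rewrite !inE xp connect0.
have {xc} /connectP[s xs cE] : connect (del_rel e (attachments p x)) x c.
  by apply: xc => //; rewrite inE (negPf xp).
suff: c \in comp_of e [set z in p] x by move/comp_notin; rewrite inE cp.
have gen y : y \in comp_of e [set z in p] x -> path (del_rel e (attachments p x)) y s ->
    last y s \in comp_of e [set z in p] x; last by rewrite cE; apply: gen.
elim: s y {xs cE} => [|z s IHs] y //= yH /andP[/and3P[yz _ zA] zs].
apply: IHs zs; apply: (comp_closed yH yz).
apply: contra zA; rewrite !inE => -> /=.
by apply/existsP; exists y; rewrite yH e_sym.
Qed.

(** * A vertex missed by a longest path: the independent set [I] *)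

Section LongestPath.
Variables (a b : T) (p : seq T).
Hypotheses (k_gt0 : 0 < k) (conn : k_connected e (2 * k)).
Hypotheses (free : H_free (P2_kP1 k) e) (tough : toughness_gt e 1%R).
Hypotheses (ab : a != b) (p_ab : epath e a b p) (p_uniq : uniq p).
Hypothesis p_max : forall r, epath e a b r -> uniq r -> size r <= size p.

Variable x : T.
Hypothesis xp : x \notin p.
Local Notation H := (comp_of e [set z in p] x).
Local Notation A := (attachments p x).

Lemma self_comp : x \in H.
Proof. by rewrite !inE xp connect0. Qed.

Lemma comp_off_path h : h \in H -> h \notin p.
Proof. by move/comp_notin; rewrite inE. Qed.

Lemma mem_attachments u h : u \in p -> h \in H -> e u h -> u \in A.
Proof. by move=> up hH uh; rewrite inE up /=; apply/existsP; exists h; rewrite hH. Qed.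

Lemma attachments_detour i j : nth x p i.-1 \in A -> nth x p j.-1 \in A ->
  exists q, detour e x p i j q /\ {subset q <= H}.
Proof.
rewrite !inE => /andP[_ /existsP[h /andP[hH eh]]] /andP[_ /existsP[h' /andP[h'H eh']]].
have [q [hq uq qH]] := comp_epath hH h'H; exists q; split=> //.
exists h, h'; split=> //; last by rewrite e_sym in eh'.
by apply/hasPn => y /qH /comp_off_path.
Qed.

Lemma succ_attachment_notin i : 0 < i -> i < size p ->
  nth x p i.-1 \in A -> nth x p i \notin A.
Proof.
move=> i0 ip iA; apply/negP => i1A.
have [q [dq _]] := @attachments_detour i i.+1 iA i1A.
exact: (no_detour_succ p_ab p_uniq p_max i0 ip dq).
Qed.

Lemma size_path_gt1 : 1 < size p.
Proof.
case: (p) p_ab => [|u [|v s]] //= /andP[/eqP ua /eqP ub].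
by move: ab; rewrite -ua -ub eqxx.
Qed.

(** Consecutive vertices of [p] are not both attachments, so one of the first two can serve as the
    separated vertex. *)
Lemma card_attachments_longest : 2 * k <= #|A|.
Proof.
have p1 := size_path_gt1.
have [p0A|p0A] := boolP (nth x p 0 \in A).
  by apply: (card_attachments conn xp (mem_nth x p1)); apply: succ_attachment_notin.
by apply: (card_attachments conn xp (mem_nth x (ltnW p1))).
Qed.

(** The end [b] is excluded because it has no successor. *)
Definition succs : {set T} := [set nth x p (index u p).+1 | u in A :\ b].

Lemma index_lt_last u : u \in A :\ b -> (index u p).+1 < size p.
Proof.
rewrite !inE => /and3P[ub up _]; have := up; rewrite -index_mem => ip.
rewrite ltn_neqAle ip andbT; apply: contra ub => /eqP szp.
by rewrite -(epath_nth_last x p_ab) -szp /= nth_index.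
Qed.

Lemma succsP w : reflect
  (exists i, [/\ 0 < i, i < size p, w = nth x p i & nth x p i.-1 \in A]) (w \in succs).
Proof.
apply: (iffP imsetP) => [[u uA ->]|[i [i0 ip -> iA]]].
  exists (index u p).+1; split=> //; first exact: index_lt_last.
  have [uA' up] : u \in A /\ u \in p by move: uA; rewrite !inE => /and3P[_ -> ->].
  by rewrite /= nth_index.
have i1p : i.-1 < size p by apply: leq_ltn_trans ip; apply: leq_pred.
exists (nth x p i.-1); last by rewrite index_uniq // prednK.
rewrite in_setD1 iA andbT -(epath_nth_last x p_ab).
rewrite nth_uniq //; last by rewrite prednK // (leq_trans _ ip).
by rewrite neq_ltn ltn_predRL prednK ?ip.
Qed.

Lemma card_succs : #|succs| = #|A :\ b|.
Proof.
apply: card_in_imset => u v uA vA /eqP; rewrite nth_uniq ?index_lt_last //.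
rewrite eqSS; move: uA vA; rewrite !inE => /and3P[_ up _] /and3P[_ vp _] /eqP.
exact: index_inj.
Qed.

Local Notation I := (x |: succs).

Lemma x_notin_succs : x \notin succs.
Proof. by apply: contra xp => /succsP[i [_ ip -> _]]; apply: mem_nth. Qed.

(** Discarding [b] loses at most one attachment, and [x] makes up for it. *)
Lemma card_I : 2 * k <= #|I|.
Proof.
rewrite cardsU1 x_notin_succs card_succs.
have := cardsD1 b A; have := card_attachments_longest.
by case: (b \in A) => /=; clear; lia.
Qed.

(** Otherwise two consecutive vertices of [p] would be attachments. *)
Lemma succs_comp_nonadj w h : w \in succs -> h \in H -> ~~ e w h.
Proof.
case/succsP=> i [i0 ip -> iA] hH; apply: contra (succ_attachment_notin i0 ip iA).
by apply: mem_attachments => //; apply: mem_nth.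
Qed.

Lemma I_independent : {in I &, forall u v, ~~ e u v}.
Proof.
move=> u v; rewrite !in_setU1 => /predU1P[->|uS] /predU1P[->|vS].
- by rewrite e_irr.
- by rewrite e_sym succs_comp_nonadj // self_comp.
- by rewrite succs_comp_nonadj // self_comp.
have [i [i0 ip -> iA]] := succsP _ uS; have [j [j0 jp -> jA]] := succsP _ vS.
have [q [dq _]] := attachments_detour iA jA.
have [q' [dq' _]] := attachments_detour jA iA.
apply/negP; case: (ltngtP i j) => [ij|ji|->]; last by rewrite e_irr.
  exact: (detour_nonadj e_sym p_ab p_uniq p_max i0 ij jp dq).
by rewrite e_sym; apply: (detour_nonadj e_sym p_ab p_uniq p_max j0 ji ip dq').
Qed.

(** * Hubs: their position on the path and their number *)

Definition hubs : {set T} := [set v | (v \notin I) && [exists u in I, e v u]].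

Lemma hubs_common v w : v \in hubs -> w \in hubs -> exists u u',
  [/\ u \in I, u' \in I, u != u', e v u && e w u & e v u' && e w u'].
Proof. by rewrite !inE -!in_setU1; apply: common_neighbours free I_independent card_I. Qed.

(** Since [v] is not adjacent to [x], both common neighbours are successors of attachments, as the
    reroutings require. *)
Lemma hubs_common_succs v w : v \in hubs -> w \in hubs -> ~~ e v x ->
  exists i j q, [/\ [/\ 0 < i, i < j & j < size p], detour e x p i j q,
    {subset q <= H}, e v (nth x p i) && e w (nth x p i) & e v (nth x p j) && e w (nth x p j)].
Proof.
move=> vS wS vx; have [u [u' [uI u'I uu' cu cu']]] := hubs_common vS wS.
have succ y : y \in I -> e v y && e w y -> y \in succs.
  by rewrite in_setU1 => /predU1P[->|//]; rewrite (negPf vx).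
have [i [i0 ip iE iA]] := succsP _ (succ _ uI cu).
have [j [j0 jp jE jA]] := succsP _ (succ _ u'I cu').
move: uu' cu cu'; rewrite iE jE => uu' cu cu'.
case: (ltngtP i j) => [ij|ji|ij]; last by rewrite ij eqxx in uu'.
  by have [q [dq qH]] := attachments_detour iA jA; exists i, j, q; split.
by have [q [dq qH]] := attachments_detour jA iA; exists j, i, q; split.
Qed.

Lemma hubs_on_path y : y \in hubs -> y \in p.
Proof.
move=> yS; apply/negPn/negP => yp.
(* Inside the component of [x], the only possible neighbour of [y] in [I] is [x], but a hub has
   two. *)
have yH : y \notin H.
  apply/negP => yH; have [u [u' [uI u'I uu' /andP[cu _] /andP[cu' _]]]] := hubs_common yS yS.
  have noS z : z \in succs -> ~~ e y z by move=> zS; rewrite e_sym succs_comp_nonadj.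
  move: uI u'I; rewrite !in_setU1.
  move=> /predU1P[ux|/noS]; last by rewrite cu.
  move=> /predU1P[u'x|/noS]; last by rewrite cu'.
  by rewrite ux u'x eqxx in uu'.
have yx : ~~ e y x.
  by apply: contra yH => yx; apply: comp_closed self_comp _ _; rewrite ?inE // e_sym.
have [i [j [q [[i0 ij jp] dq qH /andP[yi _] /andP[yj _]]]]] := hubs_common_succs yS yS yx.
apply: (detour_insert e_sym p_ab p_uniq p_max i0 ij jp dq yp _ yi yj).
by apply: contra yH => /qH.
Qed.

Lemma hubs_not_consecutive t : t.+1 < size p ->
  ~~ ((nth x p t \in hubs) && (nth x p t.+1 \in hubs)).
Proof.
move=> tp; apply/negP => /andP[tS t1S].
have succ_not i : 0 < i -> i < size p -> nth x p i.-1 \in A -> nth x p i \notin hubs.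
  move=> i0 ip iA; rewrite inE negb_and negbK in_setU1.
  by have -> : nth x p i \in succs by [apply/succsP; exists i]; rewrite orbT.
(* If p_t were adjacent to [x], then p_(t+1) would be the successor of an attachment, hence in [I]
   and not a hub. *)
have tx : ~~ e (nth x p t) x.
  apply/negP => tx; have := succ_not t.+1 isT tp; rewrite t1S => /(_ _)/negP; apply=> //.
  by apply: mem_attachments self_comp tx; apply: mem_nth; apply: ltnW.
have [i [j [q [[i0 ij jp] dq _ /andP[ti t1i] /andP[tj t1j]]]]] := hubs_common_succs tS t1S tx.
have neq l : e (nth x p t.+1) (nth x p l) -> l != t.+1.
  by apply: contraTneq => ->; rewrite e_irr.
apply: (detour_crossing e_sym p_ab p_uniq p_max i0 ij jp tp (neq _ t1j) (neq _ t1i) dq).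
by split; rewrite e_sym.
Qed.

Lemma I_sub_nonhubs : I \subset ~: hubs.
Proof. by apply/subsetP => u uI; rewrite inE inE uI. Qed.

Lemma nonhubs_independent : {in ~: hubs &, forall u v, ~~ e u v}.
Proof.
have zero u v : u \in I -> v \notin hubs -> ~~ e u v.
  move=> uI; rewrite inE negb_and negbK => /orP[vI|]; first exact: I_independent.
  by move/existsPn/(_ u); rewrite uI e_sym.
move=> u v; rewrite !in_setC => uN vN.
have [uI|uI] := boolP (u \in I); first exact: zero.
have [vI|vI] := boolP (v \in I); first by rewrite e_sym zero.
apply/negP => uv.
(* Two adjacent non-hubs outside [I] would miss all of [I], which has at least 2k >= k vertices. *)
have := P2_kP1_free_bound free uv I_independent.
rewrite ltnNge (leq_trans _ card_I) ?leq_pmull // => noI.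
by have /noI : {in I, forall z, ~~ e u z && ~~ e v z}; first by
  move=> z zI; rewrite !(e_sym _ z) !zero.
Qed.

Lemma card_hubs : #|hubs| <= #|~: hubs|.
Proof.
have sub : #|hubs| <= count [in hubs] p.
  rewrite cardE -size_filter; apply: uniq_leq_size; first exact: enum_uniq.
  by move=> y; rewrite mem_enum mem_filter => yS; rewrite yS hubs_on_path.
apply: leq_trans sub _.
have xN : x \in ~: hubs by apply: (subsetP I_sub_nonhubs); rewrite setU11.
(* The non-hub [x] off [p] absorbs the excess of one that alternation along [p] permits. *)
rewrite (cardsD1 x) xN add1n.
apply: leq_trans (_ : (count (predC [in hubs]) p).+1 <= _).
  apply: count_no_two_consecutive; apply/(sortedP x) => t tp.
  exact: hubs_not_consecutive.
rewrite ltnS -size_filter -(card_uniqP _) ?filter_uniq //.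
apply/subset_leq_card/subsetP => y; rewrite mem_filter => /andP[/= yS yp].
by rewrite in_setD1 in_setC yS andbT; apply: contraNneq xp => <-.
Qed.

Lemma no_vertex_off_longest_path : False.
Proof.
have big : 1 < #|~: hubs|.
  apply: leq_trans (subset_leq_card I_sub_nonhubs); apply: leq_trans card_I.
  by rewrite leq_pmulr.
by have := card_lt_of_tough tough nonhubs_independent big; rewrite ltnNge card_hubs.
Qed.

End LongestPath.
End Graph.

Theorem mainTheorem1 (k : nat) (T : finType) (e : rel T) :
  0 < k ->
  simple_graph e ->
  k_connected e (2 * k) ->
  H_free (P2_kP1 k) e ->
  toughness_gt e 1%R ->
  hamiltonian_connected e.
Proof.
move=> k0 [e_sym e_irr] conn free tough a b ab.
(* Lengths are bounded by the number of vertices, so a longest path exists once there is some path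
   from [a] to [b]; connectivity with nothing deleted provides one. *)
pose good n := [exists s : n.-tuple T, epath e a b s && uniq s].
have exP : exists n, good n.
  have [_ /(_ set0)] := conn; rewrite cards0 muln_gt0 k0 => /(_ isT a b).
  rewrite !inE => /(_ isT isT)/connectP[s0 as0 bE].
  case/shortenP: as0 bE => s as_ us _ bE; exists (size (a :: s)).
  have {}as_ : path e a s by apply: sub_path as_ => u v /and3P[].
  by apply/existsP; exists (in_tuple (a :: s)); rewrite /= as_ -bE !eqxx.
have bound n : good n -> n <= #|T|.
  by case/existsP=> s /andP[_ /card_uniqP sE]; rewrite -(size_tuple s) -sE max_card.
case: (ex_maxnP exP bound) => n /existsP[s /andP[s_ab s_uniq]] s_max.
have s_longest r : epath e a b r -> uniq r -> size r <= size s.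
  move=> r_ab r_uniq; rewrite size_tuple; apply: s_max.
  by apply/existsP; exists (in_tuple r); rewrite r_ab r_uniq.
have span v : v \in (s : seq T).
  apply/negPn/negP => vs.
  exact: (no_vertex_off_longest_path e_sym e_irr k0 conn free tough ab s_ab s_uniq s_longest vs).
case: (tval s) s_ab s_uniq span => [|z t] //= /and3P[/eqP-> at_ /eqP bt] ut span.
by exists t.
Qed.
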